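(* Let $X$ be a non-empty Polish space without isolated points, let $f\colon X\to\mathbb{R}$, and let $\Sigma:=\mathrm{Perf}$ be the family of all non-empty perfect subsets of $X$. Then the game $G_1(\Sigma,f)$ is determined, and - if $f$ is Marczewski measurable, then Player II has a winning strategy in the game $G_1(\Sigma,f)$; - if $f$ is not Marczewski measurable, then Player I has a winning strategy in the game $G_1(\Sigma,f)$.
   Context: A perfect set is a closed set without isolated points. A set $E\subseteq X$ is an $(s)$-set if for each $P\in\mathrm{Perf}$ there is $Q\in\mathrm{Perf}$ such that either $Q\subseteq P\cap E$ or $Q\subseteq P\setminus E$; the $(s)$-sets form a $\sigma$-algebra. A function $f\colon X\to\mathbb{R}$ is Marczewski measurable if it is measurable with respect to the $\sigma$-algebra of $(s)$-sets. The game $G_1(\Sigma,f)$, for a non-empty family $\Sigma$ of non-empty subsets of $X$ and $f\colon X\to\mathbb{R}$: Player I plays $P\in\Sigma$, Player II plays $P_0$; then at the $n$th step ($n\ge1$) Player I plays a point $x_n$ and Player II plays a set $P_n$. The rules are: $P_n\in\Sigma$ and $P_n\subseteq P$ for all $n\ge0$ (the $P_n$ need not be decreasing), and $x_{n+1}\in P_n$ for all $n\ge 0$. Player II wins if $\langle x_n\rangle$ converges in $X$ and $\lim_{n}f(x_n)=f(\lim_{n}x_n)$; otherwise Player I wins. The game is determined if one of the players has a winning strategy. *)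

(* Defs.v *)
From HB Require Import structures.
From mathcomp Require Import all_boot all_order all_algebra.
From mathcomp Require Import all_classical all_reals all_analysis.

Set Implicit Arguments.
Unset Strict Implicit.
Unset Printing Implicit Defensive.

Import Order.TTheory GRing.Theory Num.Theory.
Import numFieldNormedType.Exports.

Local Open Scope classical_set_scope.
Local Open Scope ring_scope.

Section PolishSpace.
Context (R : realType) (X : topologicalType).

Definition separable : Prop := exists2 D : set X, countable D & dense D.

Definition is_metric (d : X -> X -> R) : Prop :=
  [/\ forall x y, d x y = 0 <-> x = y,
      forall x y, d x y = d y x &
      forall x y z, d x z <= d x y + d y z].

Definition metric_induces_topology (d : X -> X -> R) : Prop :=
  forall (x : X) (A : set X),
    nbhs x A <-> exists2 e : R, 0 < e & [set y | d x y < e] `<=` A.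

Definition complete_metric (d : X -> X -> R) : Prop :=
  forall u : nat -> X,
    (forall e : R, 0 < e ->
       exists N : nat, forall m n : nat,
         (N <= m)%N -> (N <= n)%N -> d (u m) (u n) < e) ->
    exists l : X, u @ \oo --> l.

Definition polish : Prop :=
  separable /\
  exists d : X -> X -> R,
    [/\ is_metric d, metric_induces_topology d & complete_metric d].

End PolishSpace.

Section Marczewski.
Context (R : realType) (X : topologicalType).

Definition Perf : set (set X) := [set P | P !=set0 /\ perfect_set P].

Definition s_set (E : set X) : Prop :=
  forall P, Perf P ->
    exists2 Q, Perf Q & Q `<=` P `&` E \/ Q `<=` P `\` E.

(* This is [measurable_fun setT f] unfolded for the sigma-algebra of (s)-sets;
   [measurable B] means that B is a Borel subset of the real line. *)
Definition marczewski_measurable (f : X -> R) : Prop :=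
  forall B : set R, measurable B -> s_set (f @^-1` B).

End Marczewski.

Section GameG1.
Context (R : realType) (X : topologicalType).

(* A complete run of the game, legal or not: Player I plays [initial] = P,
   Player II plays [response 0] = P_0, Player I plays [point 0] = x_1,
   Player II plays [response 1] = P_1, and so on.  Beware of the shift:
   [point n] is x_(n+1), since there is no x_0. *)
Record play := Play {
  initial : set X;
  response : nat -> set X;
  point : nat -> X
}.

Context (Sigma : set (set X)) (f : X -> R).

Definition legal_I (p : play) (n : nat) : Prop :=
  if n is m.+1 then response p m (point p m) else Sigma (initial p).

Definition legal_II (p : play) (n : nat) : Prop :=
  Sigma (response p n) /\ response p n `<=` initial p.

(* The n-th move of Player I comes just before the n-th move of Player II, so
   this says that the first illegal move of the run is made by Player I. *)
Definition I_breaks_rules_first (p : play) : Prop :=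
  exists n, ~ legal_I p n /\ forall i, (i < n)%N -> legal_II p i.

Definition legal (p : play) : Prop := forall n, legal_I p n /\ legal_II p n.

Definition II_wins (p : play) : Prop :=
  I_breaks_rules_first p \/
  legal p /\
  exists l : X, point p @ \oo --> l /\ f (point p n) @[n --> \oo] --> f l.

Definition I_wins (p : play) : Prop := ~ II_wins p.

(* A strategy sees all the previous moves of the opponent; the player's own
   previous moves are determined by these.  For Player I it consists of the
   move P and of a map sending [:: P_0; ...; P_n] to x_(n+1) (its value at
   [::] is never used). *)
Definition strategy_I : Type := set X * (seq (set X) -> X).

(* For Player II it sends P and [:: x_1; ...; x_n] to P_n. *)
Definition strategy_II : Type := set X -> seq X -> set X.

Definition follows_I (s : strategy_I) (p : play) : Prop :=
  initial p = s.1 /\ forall n, point p n = s.2 (mkseq (response p) n.+1).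

Definition follows_II (t : strategy_II) (p : play) : Prop :=
  forall n, response p n = t (initial p) (mkseq (point p) n).

Definition I_has_winning_strategy : Prop :=
  exists s : strategy_I, forall p, follows_I s p -> I_wins p.

Definition II_has_winning_strategy : Prop :=
  exists t : strategy_II, forall p, follows_II t p -> II_wins p.

Definition determined : Prop :=
  I_has_winning_strategy \/ II_has_winning_strategy.

End GameG1.

(* Main.v *)
Require Import Defs.
From HB Require Import structures.
From mathcomp Require Import all_boot all_order all_algebra.
From mathcomp Require Import all_classical all_reals all_analysis.
From mathcomp Require Import lra.
Import Order.TTheory GRing.Theory Num.Theory.
Import numFieldNormedType.Exports.
Local Open Scope classical_set_scope.
Local Open Scope ring_scope.

(** The theorem is a dichotomy about the oscillation of f on perfect sets.
Call f separated on a perfect set P by reals a < b if every perfect Q included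
in P contains a point where f <= a and a point where f >= b.

If f is separated on some P, Player I opens with P and then alternately picks
points with f <= a and points with f >= b; the values f (x_n) diverge, so
Player I wins ([separated_I_wins]).

If f is Marczewski measurable, every perfect P includes a perfect Q on which f
is continuous ([marczewski_continuous_on_Perf]).  Player II answers P with such
a Q and afterwards answers each x_n with a perfect subset of the previous
answer that lies in a small ball around x_n.  Completeness makes the points
converge, the limit stays in Q, and continuity of f on Q gives the required
limit of values ([marczewski_II_wins]).

It remains to see that a function that is not Marczewski measurable is
separated on some perfect set ([not_marczewski_separated]): if no separation
occurs, all the sets {f > c} are (s)-sets, and as (s)-sets form a sigma-algebra
this suffices.

All constructions of perfect sets are instances of one fusion argument
([fusion]): given countably many families of perfect sets, each of them dense
below P for inclusion, a binary tree of perfect sets, with disjoint siblings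
and diameters tending to 0, and with its n-th splitting taken in the n-th
family, has a perfect set of branches; this set lies locally inside a member
of each of the families. *)

(** * Perfect sets and (s)-sets in a topological space *)

Section Topological.
Set Implicit Arguments.
Unset Strict Implicit.
Context {R : realType} {X : topologicalType}.

Lemma Perf_closure (A : set X) :
  A !=set0 -> A `<=` limit_point A -> Perf (closure A).
Proof.
move=> [a Aa] Alim; split; first by exists a; exact: subset_closure.
split; first exact: closed_closure.
apply/seteqP; split=> [x /subset_limit_point|x cAx U Ux].
  exact: closed_closure.
(* A point of closure A outside A differs from every point of A. *)
have [Ax|nAx] := pselect (A x).
  have [y [yx Ay Uy]] := Alim x Ax U Ux.
  by exists y; split => //; exact: subset_closure.
have [y [Ay Uy]] := cAx U Ux.
exists y; split => //; last exact: subset_closure.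
by apply/eqP => yx; apply: nAx; rewrite -yx.
Qed.

Lemma s_set0 : s_set (set0 : set X).
Proof. by move=> P PP; exists P => //; right; rewrite setD0. Qed.

Lemma s_setC (E : set X) : s_set E -> s_set (~` E).
Proof.
move=> sE P /sE[Q QP QE]; exists Q => //.
by rewrite setDE setCK -setDE; case: QE; [right|left].
Qed.

(** * Player I wins when f is separated on a perfect set *)

Definition separated_on_Perf (f : X -> R) (P : set X) (a b : R) : Prop :=
  forall Q, Perf Q -> Q `<=` P ->
    (exists2 x, Q x & f x <= a) /\ (exists2 x, Q x & b <= f x).

(** Playing alternately points with f <= a and points with f >= b keeps the values
from converging; such points exist because each answer of Player II is a
perfect subset of P. *)
Lemma separated_I_wins (f : X -> R) (P : set X) (a b : R) :
  Perf P -> a < b -> separated_on_Perf f P a b ->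
  I_has_winning_strategy (@Perf X) f.
Proof.
move=> PP ab sep; have [[x0 _] _] := PP.
pose target n : set X := if odd n then [set x | b <= f x] else [set x | f x <= a].
(* [x0] is a default value, never reached while Player II plays legally. *)
pose move (Q : set X) n := xget x0 (Q `&` target n).
exists (P, fun Qs => move (last setT Qs) (size Qs).-1) => p [p0 pS]; rewrite /= in p0.
have pE n : Defs.point p n = move (response p n) n.
  by rewrite pS mkseqS /= last_rcons size_rcons size_mkseq.
have moveP n : legal_II (@Perf X) p n -> (response p n `&` target n) (Defs.point p n).
  rewrite /legal_II p0 pE => -[RP RsubP]; apply: (xgetPex x0).
  have [[x Rx xa] [y Ry yb]] := sep _ RP RsubP.
  by rewrite /target; case: odd; [exists y|exists x].
case=> [[[|n] [nI lII]]|[pl [l [_ fl]]]].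
- by apply: nI; rewrite /legal_I p0.
- by apply: nI; have [] := moveP n (lII n (ltnSn n)).
have e0 : 0 < (b - a) / 2 by lra.
have [N _ hN] := (cvgrPdist_lt _ _).1 fl _ e0.
have tgt n : target n (Defs.point p n) by have [] := moveP n (pl n).2.
have := hN N.*2; have := hN N.*2.+1.
have := tgt N.*2; have := tgt N.*2.+1; rewrite /target /= odd_double /=.
rewrite -addnn -addnS !leq_addr => bf fa /(_ isT) + /(_ isT).
rewrite !ltr_norml => /andP[? ?] /andP[? ?]; lra.
Qed.

End Topological.

(** * Small perfect sets and nested intersections in a complete metric *)

Section CompleteMetric.
Set Implicit Arguments.
Unset Strict Implicit.
Context {R : realType} {X : topologicalType} (d : X -> X -> R).
Context (d_metric : is_metric d) (d_top : metric_induces_topology d).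
Context (d_complete : complete_metric d).

Let d0 x : d x x = 0. Proof. by case: d_metric => h _ _; apply/h. Qed.
Let dC x y : d x y = d y x. Proof. by case: d_metric. Qed.
Let d_tri x y z : d x z <= d x y + d y z. Proof. by case: d_metric. Qed.

Let d_gt0 x y : y <> x -> 0 < d x y.
Proof.
move=> yx; have ge0 : 0 <= d x y.
  by have := d_tri x y x; rewrite d0 (dC y x); lra.
rewrite lt_neqAle ge0 andbT eq_sym; apply/eqP => dxy0; apply: yx.
by case: d_metric => h _ _; apply/esym/h.
Qed.

(** The part of P near x, closed off so that it is perfect when P is; the radius
e / 2 makes e a bound for the diameter. *)
Definition piece (P : set X) (x : X) (e : R) : set X :=
  closure (P `&` [set y | d x y < e / 2]).

Lemma Perf_piece P x e : Perf P -> P x -> 0 < e -> Perf (piece P x e).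
Proof.
move=> [_ [_ Plim]] Px e0; apply: Perf_closure.
  by exists x; split => //=; rewrite d0; lra.
move=> y [Py /= dxy] U Uy.
have : nbhs y (U `&` [set z | d x z < e / 2]).
  apply: filterI => //; apply/d_top; exists (e / 2 - d x y); first by lra.
  by move=> z /= dyz; have := d_tri x y z; lra.
move: Py; rewrite -{1}Plim => /[apply] -[z [zy Pz [Uz dxz]]].
by exists z.
Qed.

Lemma piece_sub P x e : closed P -> piece P x e `<=` P.
Proof. by move=> Pc y /closureI[/Pc]. Qed.

Lemma piece_radius P x e y : piece P x e y -> d x y <= e / 2.
Proof.
move=> cy; rewrite leNgt; apply/negP => ey.
have : nbhs y [set z | d y z < d x y - e / 2].
  by apply/d_top; exists (d x y - e / 2) => //; lra.
move=> /cy[z [[_ /= dxz] dyz]].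
by have := d_tri x z y; rewrite (dC z y); lra.
Qed.

Lemma piece_diam P x e y z : piece P x e y -> piece P x e z -> d y z <= e.
Proof.
move=> /piece_radius xy /piece_radius xz.
by have := d_tri y x z; rewrite (dC y x); lra.
Qed.

(** Cantor's intersection theorem, in the form common to both uses: along a
branch of the fusion tree and along a run of the game.  Only F n.+1 is required
to be small because the first set is arbitrary in both cases. *)
Lemma nested_cvg (F : nat -> set X) (u : nat -> X) :
  (forall n, closed (F n)) -> (forall n, F n.+1 `<=` F n) ->
  (forall n x y, F n.+1 x -> F n.+1 y -> d x y <= n.+1%:R^-1) ->
  (forall n, F n (u n)) ->
  exists2 l, u @ \oo --> l & forall n, F n l.
Proof.
move=> Fc FS Fd Fu.
have Fle m n : (m <= n)%N -> F n `<=` F m.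
  elim: n => [|n IH]; first by rewrite leqn0 => /eqP ->.
  by rewrite leq_eqVlt => /predU1P[->//|/IH h x /FS]; exact: h.
have [|l ul] := @d_complete u.
  move=> e e0.
  have [N _ hN] := near_infty_natSinv_lt (PosNum e0).
  exists N.+1 => m n Nm Nn; apply: le_lt_trans (hN N (leqnn N)).
  by apply: Fd; [exact: Fle Nm _ (Fu m)|exact: Fle Nn _ (Fu n)].
exists l => // n; apply: Fc => B /ul [N _ hN].
exists (u (maxn n N)); split; last exact/hN/leq_maxr.
exact: Fle (leq_maxl n N) _ (Fu _).
Qed.

Lemma Perf_split P e : Perf P -> 0 < e ->
  exists Q : bool -> set X,
    [/\ forall b, Perf (Q b), forall b, Q b `<=` P,
        forall b x y, Q b x -> Q b y -> d x y <= e &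
        forall x, Q true x -> ~ Q false x].
Proof.
move=> PP e0; have [[x Px] [Pc Plim]] := PP.
have := Px; rewrite -{1}Plim => /(_ setT filterT)[y [/eqP yx Py _]].
have r0 := d_gt0 yx; set r := d x y in r0.
have m0 : 0 < Num.min e (r / 2) by rewrite lt_min; apply/andP; split; lra.
exists (fun b : bool => piece P (if b then x else y) (Num.min e (r / 2))).
split=> [b|b|b z w Hz Hw|z /piece_radius xz /piece_radius yz].
- by apply: Perf_piece => //; case: b.
- exact: piece_sub.
- by apply: le_trans (piece_diam Hz Hw) _; rewrite ge_min lexx.
- have : Num.min e (r / 2) <= r / 2 by rewrite ge_min lexx orbT.
  by have := d_tri x z y; rewrite -/r (dC z y); lra.
Qed.

(** * Fusion *)

(** The set K consists of the branches of a tree of perfect sets T s indexed by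
finite binary words s, read from the leaf to the root, so that T (b :: s) is
included in T s.  It is an intersection of finite unions, hence closed; it has
no isolated point because the subtree below the sibling of T s also meets K and
lies close to T s; and near a point of T s it coincides with its part inside
T s, since the other sets of the same level are finitely many and closed. *)
Lemma fusion (D : nat -> set (set X)) (P : set X) : Perf P ->
  (forall n Q, Perf Q -> Q `<=` P ->
    exists2 Q', Perf Q' & Q' `<=` Q /\ D n Q') ->
  exists2 K, Perf K & K `<=` P /\
    forall n x, K x -> exists2 Q, D n Q & \forall y \near x, K y -> Q y.
Proof.
move=> PP Ddense.
pose good n (S : set X) (Q : bool -> set X) :=
  [/\ forall b, Perf (Q b), forall b, Q b `<=` S, forall b, D n (Q b),
      forall b x y, Q b x -> Q b y -> d x y <= n.+1%:R^-1 &
      forall x, Q true x -> ~ Q false x].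
have step (nS : nat * set X) : exists Q,
    Perf nS.2 -> nS.2 `<=` P -> good nS.1 nS.2 Q.
  case: nS => n S /=.
  have [[PS SP]|nPS] := pselect (Perf S /\ S `<=` P); last first.
    by exists (fun=> S) => ? ?; case: nPS.
  have n0 : (0 : R) < n.+1%:R^-1 by rewrite invr_gt0.
  have [Q [QPerf QS Qd Qdisj]] := Perf_split PS n0.
  have dense b : exists Q', Perf Q' /\ Q' `<=` Q b /\ D n Q'.
    have [Q' QP' [Q'Q DQ']] := Ddense n (Q b) (QPerf b) (subset_trans (QS b) SP).
    by exists Q'.
  have [Q' hQ'] := choice dense.
  exists Q' => _ _; split=> [b|b|b|b x y Hx Hy|x Hx Hy].
  - by case: (hQ' b).
  - by case: (hQ' b) => _ [Q'Q _]; exact: subset_trans Q'Q (QS b).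
  - by case: (hQ' b) => _ [].
  - by case: (hQ' b) => _ [Q'Q _]; apply: (Qd b); exact: Q'Q.
  - case: (hQ' true) (hQ' false) => _ [Q'T _] [_ [Q'F _]].
    by apply: (Qdisj x); [exact: Q'T|exact: Q'F].
have [g hg] := choice step.
pose T := fix T (s : seq bool) : set X :=
  if s is b :: t then g (size t, T t) b else P.
have TP s : Perf (T s) /\ T s `<=` P.
  elim: s => [|b s [Ts sP]] /=; first by split.
  have [/= gP gS _ _ _] := hg (size s, T s) Ts sP.
  by split; [exact: gP|exact: subset_trans (gS b) sP].
have Tgood s : good (size s) (T s) (fun b => T (b :: s)).
  by have [Ts sP] := TP s; exact: (hg (size s, T s) Ts sP).
have Tcat s t : T (s ++ t) `<=` T t.
  elim: s => [|b s IH] x //=; have [_ gS _ _ _] := Tgood (s ++ t).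
  by move/gS/IH.
have Tinj s t x : size s = size t -> T s x -> T t x -> s = t.
  elim: s t => [|b s IH] [|c t]// [st] sx tx.
  have [_ gS _ _ _] := Tgood s; have [_ gT _ _ _] := Tgood t.
  have est := IH t st (gS _ _ sx) (gT _ _ tx); rewrite -est in tx *.
  have [_ _ _ _ disj] := Tgood s; have nd := disj x.
  by case: b c sx tx {gT} => -[] // sx tx; case: nd.
pose level n := \bigcup_(s in [set s : seq bool | size s = n]) T s.
pose K := \bigcap_(n in [set: nat]) level n.
(* Always turning to the same side below s gives a branch. *)
have Tmeet s : exists2 x, K x & T s x.
  pose F k := T (nseq k true ++ s).
  have Fne k : exists x, F k x.
    by have [[[x Fx] _] _] := TP (nseq k true ++ s); exists x.
  have [u Fu] := choice Fne.
  have [|||//|l _ Fl] := @nested_cvg F u.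
  - by move=> n; have [[_ []]] := TP (nseq n true ++ s).
  - by move=> n x; exact: (Tcat [:: true]).
  - move=> n x y Fx Fy; have [_ _ _ dm _] := Tgood (nseq n true ++ s).
    apply: le_trans (dm _ _ _ Fx Fy) _.
    rewrite lef_pV2 ?posrE// ler_nat ltnS size_cat size_nseq; exact: leq_addr.
  exists l; last exact: (Fl 0%N).
  move=> n _; exists (drop (size s) (nseq n true ++ s)).
    by rewrite /= size_drop size_cat size_nseq addnK.
  apply: (Tcat (take (size s) (nseq n true ++ s))).
  by rewrite cat_take_drop; exact: Fl.
have level_finite n : finite_set [set s : seq bool | size s = n].
  suff -> : [set s : seq bool | size s = n] = range (@tval n bool).
    by apply: finite_image; exact: finite_finset.
  apply/seteqP; split=> [s /= /eqP sn|_ [t _ <-]/=]; last exact: size_tuple.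
  by exists (Tuple sn).
have Kc : closed K.
  apply: closed_bigI => n _; apply: closed_bigcup => // s _.
  by have [[_ []]] := TP s.
exists K; first split.
- by have [x Kx _] := Tmeet [::]; exists x.
- split=> //; apply/seteqP; split=> [x /subset_limit_point|x Kx U Ux].
    exact: Kc.
  have [e e0 eU] := (d_top x U).1 Ux.
  have [n _ hn] := near_infty_natSinv_lt (PosNum e0).
  (* The tree at level n.+2 : the parent c :: s of the two siblings has a
     diameter controlled by the splitting of its own parent s, of length n. *)
  have [[|b [|c s]]// [sn] sx] := Kx n.+2 I.
  have [y Ky sy] := Tmeet (~~ b :: c :: s).
  have [_ gS _ _ disj] := Tgood (c :: s).
  exists y; split => //.
    apply/eqP => yx; rewrite yx in sy.
    by have nd := disj x; case: b sx sy => ? ?; case: nd.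
  have [_ _ _ dm _] := Tgood s.
  apply: eU => /=; apply: le_lt_trans (dm c x y (gS _ _ sx) (gS _ _ sy)) _.
  by rewrite sn; exact: (hn n (leqnn n)).
split=> [x Kx|n x Kx].
  by have [s _ sx] := Kx 0%N I; exact: (TP s).2.
have [[|b s]// [sn] sx] := Kx n.+1 I.
exists (T (b :: s)); first by have [_ _ + _ _] := Tgood s; rewrite sn; exact.
pose C := \bigcup_(t in [set t : seq bool | size t = n.+1] `\ (b :: s)) T t.
have Cc : closed C.
  apply: closed_bigcup => [|t _]; last by have [[_ []]] := TP t.
  by apply: finite_setD; exact: level_finite.
have : nbhs x (~` C).
  apply: open_nbhs_nbhs; split; first exact: closed_openC.
  by move=> [t [/= tn ts] tx]; apply: ts; apply: Tinj tx sx; rewrite /= sn.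
apply: filterS => y nCy Ky; have [t tn ty] := Ky n.+1 I.
have [<-//|ts] := pselect (t = b :: s).
by case: nCy; exists t.
Qed.

(** * (s)-sets form a sigma-algebra *)

(** Fusion for the families of sets disjoint from E n. *)
Lemma Perf_avoid (E : nat -> set X) (P : set X) : Perf P ->
  (forall n Q, Perf Q -> Q `<=` P -> exists2 Q', Perf Q' & Q' `<=` Q `\` E n) ->
  exists2 Q, Perf Q & Q `<=` P `\` \bigcup_n E n.
Proof.
move=> PP PE.
have [||K KPerf [KP KE]] := @fusion (fun n => [set Q | Q `<=` ~` E n]) P => //.
  move=> n Q QPerf QP; have [Q' Q'Perf Q'E] := PE n Q QPerf QP.
  by exists Q' => //; split=> x /Q'E[].
exists K => // x Kx; split; first exact: KP.
move=> [n _ Ex]; have [Q QE /nbhs_singleton KQ] := KE n x Kx.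
exact: QE (KQ Kx) Ex.
Qed.

(** If no perfect subset of P is included in some E n, then every perfect subset
of P can be shrunk to avoid E n, and a fusion avoids all of them at once.  This
form also yields that a perfect set covered by countably many (s)-sets has a
perfect subset inside one of them. *)
Lemma s_set_bigcup_dichotomy (E : nat -> set X) (P : set X) :
  (forall n, s_set (E n)) -> Perf P ->
  (exists n, exists2 Q, Perf Q & Q `<=` P `&` E n) \/
  exists2 Q, Perf Q & Q `<=` P `\` \bigcup_n E n.
Proof.
move=> sE PP; have [|nE] := pselect (exists n, exists2 Q, Perf Q & Q `<=` P `&` E n).
  by left.
right; apply: Perf_avoid => // n Q QPerf QP.
have [Q' Q'Perf [Q'E|]] := sE n Q QPerf; last by exists Q'.
case: nE; exists n, Q' => // x /Q'E[Qx Ex].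
by split => //; exact: QP.
Qed.

Lemma s_set_bigcup (E : nat -> set X) :
  (forall n, s_set (E n)) -> s_set (\bigcup_n E n).
Proof.
move=> sE P PP.
have [[n [Q QPerf QE]]|[Q QPerf QE]] := s_set_bigcup_dichotomy sE PP.
  by exists Q => //; left => x /QE[Px Ex]; split => //; exists n.
by exists Q => //; right.
Qed.

(** * Marczewski measurability in terms of perfect sets *)

Lemma marczewski_measurable_of_rays (f : X -> R) :
  (forall c, s_set [set x | c < f x]) -> marczewski_measurable f.
Proof.
move=> fr; have raysE : (measurable : set (set R)) = _ :=
  measurable_realfun.RGenOInfty.measurableE R.
move=> B; rewrite raysE.
apply: (@smallest_sub _ _ _ [set B | s_set (f @^-1` B)]); last first.
  by move=> _ [c ->] /=; have := fr c; congr s_set; apply/seteqP; split => x /=;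
    rewrite in_itv/= andbT.
split=> [|A sA|A sA] /=.
- by rewrite preimage_set0; exact: s_set0.
- by rewrite setTD preimage_setC; exact: s_setC.
- by rewrite preimage_bigcup; exact: s_set_bigcup.
Qed.

(** Without separation, {f > c} is an (s)-set: if no perfect subset of P lies in
{f > c}, non-separation with a = c and b = c + 1/(n+1) shows that every
perfect subset of P can be shrunk into {f < c + 1/(n+1)}, and a fusion over n
produces a perfect subset of P where f <= c. *)
Lemma not_marczewski_separated (f : X -> R) : ~ marczewski_measurable f ->
  exists P a b, [/\ Perf P, a < b & separated_on_Perf f P a b].
Proof.
move=> nf; apply: contrapT => nsep; apply: nf.
apply: marczewski_measurable_of_rays => c P PP.
have [[Q QPerf QPc]|nQ] := pselect (exists2 Q, Perf Q & Q `<=` P `&` [set x | c < f x]).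
  by exists Q => //; left.
pose E n := [set x | c + n.+1%:R^-1 <= f x].
have [//||Q QPerf QE] := @Perf_avoid E P.
  move=> n Q QPerf QP; apply: contrapT => nQ'; apply: nsep.
  exists Q, c, (c + n.+1%:R^-1); split => //; first by rewrite ltrDl invr_gt0.
  move=> S SPerf SQ; split; apply: contrapT => nx.
    apply: nQ; exists S => // x Sx; split; first exact/QP/SQ.
    by rewrite /= ltNge; apply/negP => fx; apply: nx; exists x.
  apply: nQ'; exists S => // x Sx; split; first exact: SQ.
  by move=> Ex; apply: nx; exists x.
exists Q => //; right => x /QE[Px nEx]; split => // /= cfx; apply: nEx.
have e0 : 0 < f x - c by lra.
have [n _ hn] := near_infty_natSinv_lt (PosNum e0).
by exists n => //; rewrite /E /= -lerBrDl; exact: ltW (hn n (leqnn n)).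
Qed.

(** Cutting the line into intervals of length 1/(n+1) covers each perfect set by
countably many (s)-sets, so that it has a perfect subset where f oscillates by
less than 1/(n+1); a fusion over n gives continuity. *)
Lemma marczewski_continuous_on_Perf (f : X -> R) (P : set X) :
  marczewski_measurable f -> Perf P ->
  exists2 Q, Perf Q & Q `<=` P /\
    forall x, Q x -> f y @[y --> within Q (nbhs x)] --> f x.
Proof.
move=> mf PP.
pose D n := [set Q | forall x y : X, Q x -> Q y -> `|f x - f y| < n.+1%:R^-1].
have [//||K KPerf [KP KD]] := @fusion D P.
  move=> n Q QPerf QP; set e : R := n.+1%:R^-1.
  have e0 : 0 < e by rewrite invr_gt0.
  (* The intervals [z e, (z + 1) e) for integers z, indexed by the codes of z;
     a number that codes no integer gets the empty set. *)
  pose I k : set R := if @unpickle int k is Some z then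
    [set` `[z%:~R * e, (z + 1)%:~R * e[] else set0.
  have mI k : measurable (I k).
    by rewrite /I; case: unpickle => [z|]; [exact: measurable_itv|exact: measurable0].
  have [|//|[k [S SPerf SI]]|[S [[x Sx] _] SI]] :=
      @s_set_bigcup_dichotomy (fun k => f @^-1` I k) Q.
  - by move=> k; exact: mf.
  - exists S => //; split=> [x /SI[]//|x y /SI[_ +] /SI[_ +]].
    rewrite /= /I; case: unpickle => [z|//] /=; rewrite !in_itv/= !intrD !mulrDl !mul1r.
    rewrite -/e => /andP[? ?] /andP[? ?]; rewrite ltr_norml; apply/andP; split; lra.
  - have [_ []] := SI x Sx; exists (pickle (Num.floor (f x / e))) => //=.
    rewrite /I pickleK /= in_itv /= -ler_pdivlMr// -ltr_pdivrMr//.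
    by rewrite floor_le floorD1_gt.
exists K => //; split=> // x Kx; apply/cvgrPdist_lt => e e0.
have [n _ hn] := near_infty_natSinv_lt (PosNum e0).
have [S DS KS] := KD n x Kx.
have Sx : S x by exact: nbhs_singleton KS Kx.
apply: filterS KS => y KSy Ky; apply: lt_trans (DS x y Sx (KSy Ky)) _.
exact: (hn n (leqnn n)).
Qed.

(** * Player II wins when f is Marczewski measurable *)

(** The answer of Player II after the points xs, latest first, when the answer
to the opening was Q. *)
Fixpoint refine (Q : set X) (xs : seq X) : set X :=
  if xs is x :: ys then piece (refine Q ys) x (size ys).+1%:R^-1 else Q.

(** The answers decrease inside a perfect set where f is continuous, and their
diameters tend to 0. *)
Lemma marczewski_II_wins (f : X -> R) :
  marczewski_measurable f -> II_has_winning_strategy (@Perf X) f.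
Proof.
move=> mf.
have restr P : exists Q, Perf P -> [/\ Perf Q, Q `<=` P &
    forall x, Q x -> f y @[y --> within Q (nbhs x)] --> f x].
  have [PP|nPP] := pselect (Perf P); last by exists P.
  have [Q QPerf [QP Qf]] := marczewski_continuous_on_Perf mf PP.
  by exists Q.
have [q hq] := choice restr.
exists (fun P xs => refine (q P) (rev xs)) => p pf.
have [|nbreak] := pselect (I_breaks_rules_first (@Perf X) p); first by left.
right; set F := response p; set u := Defs.point p.
have F0 : F 0%N = q (initial p) by rewrite /F pf.
have FS n : F n.+1 = piece (F n) (u n) n.+1%:R^-1.
  by rewrite /F !pf mkseqS rev_rcons /= size_rev size_mkseq.
have legal_step n : Perf (initial p) -> (forall i, (i < n)%N -> F i (u i)) ->
    Perf (F n) /\ F n `<=` q (initial p).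
  move=> /hq[QPerf _ _]; elim: n => [|n IH] Fu; first by rewrite F0; split.
  have [|FP FQ] := IH; first by move=> i ni; apply/Fu/ltnW.
  rewrite FS; split.
    by apply: Perf_piece FP (Fu n (ltnSn n)) _; rewrite invr_gt0.
  by apply: subset_trans FQ; apply: piece_sub; case: FP => _ [].
(* As Player I never breaks the rules first, legality propagates by strong
   induction: legal moves of both players before step n make the moves at step
   n legal. *)
have pl : legal (@Perf X) p.
  move=> n; have [k] := ubnP n; elim: k n => // k IH n; rewrite ltnS => nk.
  have lI : legal_I (@Perf X) p n.
    apply: contrapT => nl; apply: nbreak; exists n; split => // i ni.
    by have [] := IH i (leq_trans ni nk).
  split=> //.
  have lI0 i : (i <= n)%N -> legal_I (@Perf X) p i.
    rewrite leq_eqVlt => /predU1P[->//|ni].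
    by have [] := IH i (leq_trans ni nk).
  have iP : Perf (initial p) by exact: (lI0 0%N).
  have [|FP FQ] := @legal_step n iP; first by move=> i ni; exact: (lI0 i.+1).
  by split => //; apply: subset_trans FQ _; case: (hq _ iP).
split=> //.
have iP : Perf (initial p) by have [] := pl 0%N.
have FP n : Perf (F n) by have [_ []] := pl n.
have Fc n : closed (F n) by case: (FP n) => _ [].
have Fu n : F n (u n) by have [] := pl n.+1.
have [||l ul Fl] := @nested_cvg F u Fc _ _ Fu.
- by move=> n; rewrite FS; exact: piece_sub.
- by move=> n x y; rewrite FS; exact: piece_diam.
exists l; split => //.
have [_ _ /(_ l)] := hq _ iP; rewrite -F0 => /(_ (Fl 0%N)).
apply: cvg_comp => B /ul [N _ uB]; exists N => // n Nn; apply: (uB n Nn).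
by have [_ FQ] := legal_step n iP (fun i _ => Fu i); rewrite F0; exact: FQ (Fu n).
Qed.

End CompleteMetric.

Theorem corollary4p4 (R : realType) (X : topologicalType)
    (X_nonempty : [set: X] !=set0)
    (X_polish : polish R X)
    (X_no_isolated : isolated [set: X] = set0)
    (f : X -> R) :
  determined (@Perf X) f /\
  (marczewski_measurable f -> II_has_winning_strategy (@Perf X) f) /\
  (~ marczewski_measurable f -> I_has_winning_strategy (@Perf X) f).
Proof.
have [_ [d [d_metric d_top d_complete]]] := X_polish.
have II_wins : marczewski_measurable f -> II_has_winning_strategy (@Perf X) f.
  exact: marczewski_II_wins d_metric d_top d_complete _.
have I_wins : ~ marczewski_measurable f -> I_has_winning_strategy (@Perf X) f.
  move=> nf; have [P [a [b [PP ab sep]]]] :=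
    not_marczewski_separated d_metric d_top d_complete nf.
  exact: separated_I_wins PP ab sep.
split=> //.
by have [/II_wins|/I_wins] := pselect (marczewski_measurable f); [right|left].
Qed.
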